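(* In the disk algebra $\mathscr{A}(\mathbb{D})$, zero is the only zero divisor.
   Context: Let $\mathbb{D}=\{z\in\mathbb{C}:|z|<1\}$ and let $\bar{\mathbb{D}}$ be its closure. The disk algebra $\mathscr{A}(\mathbb{D})$ is the Banach algebra, under pointwise operations and the supremum norm, of all complex-valued functions continuous on $\bar{\mathbb{D}}$ and analytic in $\mathbb{D}$. An element $z$ of a ring $R$ is called a zero divisor if either $zx=0$ for some non-zero $x\in R$ or $yz=0$ for some non-zero $y\in R$; in particular, in a non-zero ring the element $0$ counts as a zero divisor. *)

(* Defs.v *)
From HB Require Import structures.
From mathcomp Require Import all_boot all_order all_algebra.
From mathcomp Require Import all_classical all_reals all_analysis.
From mathcomp Require Import complex.

Set Implicit Arguments.
Unset Strict Implicit.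
Unset Printing Implicit Defensive.

Import Order.TTheory GRing.Theory Num.Theory.
Import numFieldNormedType.Exports.
Local Open Scope classical_set_scope.
Local Open Scope ring_scope.
Local Open Scope complex_scope.

(* The library only puts the norm topology on numeric fields [K] that are
   variables or of the form [K^o]; transfer it to [R[i]]. *)
HB.instance Definition _ (R : realType) := GRing.ComAlgebra.copy R[i] (R[i])^o.
HB.instance Definition _ (R : realType) := Vector.copy R[i] (R[i])^o.
HB.instance Definition _ (R : realType) := NormedModule.copy R[i] (R[i])^o.

Definition zero_divisor (A : pzRingType) (z : A) : Prop :=
  (exists2 x : A, x != 0 & z * x = 0) \/ (exists2 y : A, y != 0 & y * z = 0).

Section disk_algebra_def.
Variable R : realType.

Definition analytic_at (f : R[i] -> R[i]) (z0 : R[i]) : Prop :=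
  exists a : nat -> R[i],
    \forall z \near z0, [series a k * (z - z0) ^+ k]_k @ \oo --> f z.

Definition unit_disk : set R[i] := [set z | `|z| < 1].

Definition closed_unit_disk : set R[i] := closure unit_disk.

(* ['valL_ 0 f] extends [f] by [0] outside the closed disk; only the values of
   [f] near a point of the open disk matter for analyticity there. *)
Definition disk_fun : set (closed_unit_disk -> R[i]) :=
  [set f | continuous f /\
           forall z, unit_disk z -> analytic_at ('valL_ 0 f) z].

End disk_algebra_def.
Arguments unit_disk R : clear implicits.
Arguments closed_unit_disk R : clear implicits.
Arguments disk_fun R : clear implicits.

Section analytic_at_ring.
Variable R : realType.
Implicit Types (f g : R[i] -> R[i]) (A B : nat -> R[i]) (z : R[i]).

Lemma cvg_harmonicC (M : R[i]) : 0 <= M ->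
  (fun n => M / n.+1%:R : R[i]) @ \oo --> (0 : R[i]).
Proof.
move=> M0; apply/cvgrPdist_lt => e e0.
have Me0 : 0 <= M / e by rewrite divr_ge0// ltW.
have MeE : M / e = (complex.Re (M / e))%:C by apply/esym/RRe_real/ger0_real.
near=> n.
rewrite sub0r normrN ger0_norm ?divr_ge0//.
rewrite ltr_pdivrMr ?ltr0n// mulrC -ltr_pdivrMr// MeE.
rewrite -[X in _ < X](rmorph_nat (real_complex R)) ltcR -natr1.
apply: (@lt_trans _ _ n%:R); last by rewrite ltrDl.
near: n; exact: nbhs_infty_gtr.
Unshelve. all: by end_near. Qed.

Definition cauchy_prod A B (k : nat) : R[i] :=
  \sum_(i < k.+1) A i * B (k - i)%N.

Lemma series_cauchy_prod A B n :
  \sum_(i < n) A i * \sum_(j < n - i) B j = \sum_(k < n) cauchy_prod A B k.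
Proof.
elim: n => [|n IHn]; first by rewrite !big_ord0.
rewrite [RHS]big_ord_recr -IHn /cauchy_prod /=.
rewrite [LHS]big_ord_recr [X in _ = _ + X]big_ord_recr/=.
rewrite subSn// subnn big_ord1 addrA; congr (_ + _).
rewrite -big_split/=; apply: eq_bigr => i _.
by rewrite subSn ?(ltnW (ltn_ord i))// big_ord_recr/= mulrDr.
Qed.

Lemma cauchy_prod_remainder A B (M N : R[i]) n :
  (forall k, `|A k| <= M / 8 ^+ k) -> (forall k, `|B k| <= N / 8 ^+ k) ->
  `|(\sum_(i < n) A i) * (\sum_(j < n) B j) - \sum_(k < n) cauchy_prod A B k|
  <= M * N / n.+1%:R.
Proof.
move=> AM BN.
have M0 : 0 <= M by have := AM 0%N; rewrite expr0 divr1; exact: le_trans.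
have N0 : 0 <= N by have := BN 0%N; rewrite expr0 divr1; exact: le_trans.
rewrite -series_cauchy_prod mulr_suml -sumrB.
apply: (@le_trans _ _ (\sum_(i < n) n%:R * (M * N / 8 ^+ n))).
  apply: le_trans (ler_norm_sum _ _ _) _; apply: ler_sum => i _.
  rewrite -mulrBr -!(big_mkord xpredT B).
  rewrite (big_cat_nat _ (n := n - i))//= ?leq_subr// addrAC subrr add0r.
  rewrite mulr_sumr; apply: le_trans (ler_norm_sum _ _ _) _.
  rewrite big_nat_cond.
  apply: (@le_trans _ _ (\sum_(n - i <= j < n) (M * N / 8 ^+ n))).
    rewrite [leRHS]big_nat_cond; apply: ler_sum => j /andP[/andP[nij jn] _].
    rewrite normrM; apply: (@le_trans _ _ (M / 8 ^+ i * (N / 8 ^+ j))).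
      by apply: ler_pM.
    rewrite mulrACA -invfM -exprD ler_wpM2l ?mulr_ge0//.
    rewrite lef_pV2 ?posrE ?exprn_gt0// ler_eXn2l ?ltr1n//.
    by rewrite -leq_subLR.
  rewrite sumr_const_nat -[leLHS]mulr_natl ler_wpM2r//.
    by rewrite divr_ge0 ?mulr_ge0// exprn_ge0.
  by rewrite ler_nat leq_subr.
rewrite sumr_const card_ord -[leLHS]mulr_natl mulrA -natrM mulrCA.
rewrite ler_wpM2l ?mulr_ge0//.
rewrite ler_pdivrMr ?exprn_gt0// mulrC ler_pdivlMr ?ltr0n//.
rewrite -natrX -natrM ler_nat.
have -> : (8 ^ n = 2 ^ n * 2 ^ n * 2 ^ n)%N by rewrite -!expnMn.
have n2 : (n < 2 ^ n)%N by exact: ltn_expl.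
by apply: leq_mul => //; apply: leq_mul; exact: ltnW.
Qed.

Lemma cvg_cauchy_prod A B (M N a b : R[i]) :
  (forall k, `|A k| <= M / 8 ^+ k) -> (forall k, `|B k| <= N / 8 ^+ k) ->
  series A @ \oo --> a -> series B @ \oo --> b ->
  series (cauchy_prod A B) @ \oo --> a * b.
Proof.
move=> AM BN Aa Bb.
have M0 : 0 <= M by have := AM 0%N; rewrite expr0 divr1; exact: le_trans.
have N0 : 0 <= N by have := BN 0%N; rewrite expr0 divr1; exact: le_trans.
have D0 : (series A \* series B - series (cauchy_prod A B)) @ \oo -->
          (0 : R[i]).
  apply/cvgrPdist_lt => e e0.
  have /cvgrPdist_lt/(_ e e0) := cvg_harmonicC (mulr_ge0 M0 N0).
  apply: filterS => n; rewrite !sub0r !normrN; apply: le_lt_trans.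
  rewrite [leRHS]ger0_norm ?divr_ge0 ?mulr_ge0//.
  by rewrite !seriesEord; exact: cauchy_prod_remainder.
have -> : series (cauchy_prod A B) = series A \* series B -
    (series A \* series B - series (cauchy_prod A B)).
  by apply/funext => n; apply/esym; exact: subKr.
rewrite -[a * b]subr0; exact: cvgB (cvgM Aa Bb) D0.
Qed.

Lemma analytic_at_bound f z0 (a : nat -> R[i]) :
  (\forall z \near z0, [series a k * (z - z0) ^+ k]_k @ \oo --> f z) ->
  exists M : R[i], \forall z \near z0,
    forall k, `|a k * (z - z0) ^+ k| <= M / 8 ^+ k.
Proof.
move=> /nbhs_ballP[e /= e0 fe].
have e20 : 0 < e / 2 by rewrite divr_gt0.
have zw : ball z0 e (z0 + e / 2).
  rewrite -ball_normE/= opprD addNKr normrN gtr0_norm// ltr_pdivrMr//.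
  by rewrite mulr_natr mulr2n ltrDl.
have cvga := fe _ zw.
have {}cvga : [series a k * (e / 2) ^+ k]_k @ \oo --> f (z0 + e / 2).
  by move: cvga; rewrite (addrC z0) addrK.
have /cvg_series_cvg_0/cvgP/cvg_seq_bounded := cvgP _ cvga.
move=> [M0 [M0r]] /(_ (M0 + 1)).
rewrite ltrDl ltr01 => /(_ isT) aM; exists (M0 + 1).
have e160 : 0 < e / 2 / 8 by rewrite !divr_gt0.
have near_z0 : \forall z \near z0, `|z0 - z| < e / 2 / 8.
  by apply/nbhs_ballP; exists (e / 2 / 8) => //= z; rewrite -ball_normE.
apply: filterS near_z0 => z; rewrite distrC => /ltW zz0 k.
rewrite normrM normrX.
have := aM k I; rewrite /= normrM normrX (gtr0_norm e20) => aMk.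
apply: (@le_trans _ _ (`|a k| * (e / 2 / 8) ^+ k)).
  by rewrite ler_wpM2l// lerXn2r ?nnegrE// divr_ge0// ltW.
by rewrite [(_ / 8) ^+ k]expr_div_n mulrA ler_wpM2r// invr_ge0 exprn_ge0.
Qed.

Lemma analytic_atM f g z0 :
  analytic_at f z0 -> analytic_at g z0 -> analytic_at (f * g) z0.
Proof.
move=> [a fa] [b gb]; exists (cauchy_prod a b).
have [M aM] := analytic_at_bound fa; have [N bN] := analytic_at_bound gb.
apply: filterS2 (filterI fa aM) (filterI gb bN) => z [fz aMz] [gz bNz].
have <- : cauchy_prod (fun k => a k * (z - z0) ^+ k)
                      (fun k => b k * (z - z0) ^+ k) =
          (fun k => cauchy_prod a b k * (z - z0) ^+ k).
  apply/funext => k; rewrite /cauchy_prod mulr_suml; apply: eq_bigr => i _.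
  by rewrite mulrACA -exprD subnKC// -ltnS.
exact: cvg_cauchy_prod aMz bNz fz gz.
Qed.

Lemma analytic_atB f g z0 :
  analytic_at f z0 -> analytic_at g z0 -> analytic_at (f - g) z0.
Proof.
move=> [a fa] [b gb]; exists (fun k => a k - b k).
apply: filterS2 fa gb => z fz gz.
have -> : [series (a k - b k) * (z - z0) ^+ k]_k =
    [series a k * (z - z0) ^+ k]_k - [series b k * (z - z0) ^+ k]_k.
  apply/funext => n; rewrite /series/=.
  apply: etrans (sumrB _ _ _ _).
  by apply: eq_bigr => k _; rewrite mulrBl.
exact: cvgB fz gz.
Qed.

Lemma analytic_at1 f z0 : (\forall z \near z0, f z = 1) -> analytic_at f z0.
Proof.
move=> f1; exists (fun k => (k == 0%N)%:R); apply: filterS f1 => z ->.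
apply: cvg_near_cst; exists 1%N => //= -[//|n] _; rewrite /series/=.
rewrite big_nat_recl// expr0 mulr1 big1 ?addr0// => i _.
by rewrite mul0r.
Qed.

Lemma open_unit_disk : open (unit_disk R).
Proof.
have -> : unit_disk R = ball 0 1.
  by apply/seteqP; split=> z; rewrite -ball_normE/= sub0r normrN.
exact: ball_open.
Qed.

End analytic_at_ring.

Section disk_algebra.
Variable R : realType.
Implicit Types f g : closed_unit_disk R -> R[i].

Lemma disk_fun_subring_closed : subring_closed (mem (disk_fun R)).
Proof.
split=> [|f g|f g].
- apply/mem_set; split=> [|z Dz]; first exact: cst_continuous.
  apply: analytic_at1.
  have : nbhs z (unit_disk R) by exact/open_nbhs_nbhs/(conj (@open_unit_disk R)).
  apply: filterS => w Dw; rewrite /= oinv_set_val insubT//=.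
  exact/mem_set/subset_closure.
- move=> /set_mem[fc fa] /set_mem[gc ga]; apply/mem_set; split=> [x|z Dz].
    by apply: continuousB; [exact: fc|exact: gc].
  have -> : 'valL_ 0 (f - g) = 'valL_ 0 f - 'valL_ 0 g.
    apply/funext => w; rewrite /valL_/=.
    suff : oapp (f - g) 0 ('oinv_set_val w) =
           oapp f 0 ('oinv_set_val w) - oapp g 0 ('oinv_set_val w) by [].
    by case: ('oinv_set_val w) => [x|] //=; rewrite subr0.
  by apply: analytic_atB; [exact: fa|exact: ga].
- move=> /set_mem[fc fa] /set_mem[gc ga]; apply/mem_set; split=> [x|z Dz].
    by apply: continuousM; [exact: fc|exact: gc].
  have -> : 'valL_ 0 (f * g) = 'valL_ 0 f * 'valL_ 0 g.
    apply/funext => w; rewrite /valL_/=.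
    suff : oapp (f * g) 0 ('oinv_set_val w) =
           oapp f 0 ('oinv_set_val w) * oapp g 0 ('oinv_set_val w) by [].
    by case: ('oinv_set_val w) => [x|] //=; rewrite mulr0.
  by apply: analytic_atM; [exact: fa|exact: ga].
Qed.

Definition disk_fun_pred : {pred closed_unit_disk R -> R[i]} :=
  mem (disk_fun R).

Record disk_algebra := DiskAlgebra {
  disk_val :> closed_unit_disk R -> R[i];
  disk_valP : disk_val \in disk_fun_pred }.

HB.instance Definition _ := [isSub for disk_val].
HB.instance Definition _ := [Choice of disk_algebra by <:].
HB.instance Definition _ :=
  GRing.SubChoice_isSubComPzRing.Build _ disk_fun_pred disk_algebra
    disk_fun_subring_closed.

End disk_algebra.

(* Main.v *)
Require Import Defs.
From mathcomp Require Import all_boot all_order all_algebra.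
From mathcomp Require Import all_classical all_reals all_analysis complex ring.
Set Implicit Arguments.
Unset Strict Implicit.
Unset Printing Implicit Defensive.
Import Order.TTheory GRing.Theory Num.Theory numFieldNormedType.Exports.
Local Open Scope classical_set_scope.
Local Open Scope ring_scope.
Local Open Scope complex_scope.

(** The disk algebra is an integral domain because zeros of analytic functions
are isolated.

At an interior point [z0], an analytic function either has only zero
coefficients, and vanishes near [z0], or has a first non-zero coefficient
[a m], whose term [a m * (z - z0) ^+ m] outweighs the sum of all later ones
near [z0], so that the function has no zero in a punctured neighbourhood
([analytic_at_isolated_zero]; the estimate is [series_norm_ge]).  If [f * g = 0],
the second case cannot hold at [0] for both [f] and [g]: two punctured
neighbourhoods of [0] meet.  So one of them, say [f], vanishes near [0].

Vanishing near a point spreads over the open disk.  The interior of the zero set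
of [f] is open, and the same alternative shows that it is relatively closed in
the disk; as the disk is connected ([connected_unit_disk]), it is the whole disk
([identity_theorem]).  Finally [f = 0] on the closed disk by continuity, because
the open disk is dense in it ([eq0_on_unit_disk]).

Conversely [0] is a zero divisor because the constant function [1] differs
from [0]. *)

Lemma sum_expr_le2 (K : numFieldType) (x : K) n :
  0 <= x -> x <= 1 / 2 -> \sum_(0 <= i < n) x ^+ i <= 2.
Proof.
move=> x0 x12.
(* The term [2 * x ^+ n], a bound for the missing tail, makes the induction go
   through. *)
suff : \sum_(0 <= i < n) x ^+ i + 2 * x ^+ n <= 2.
  by apply: le_trans; rewrite lerDl mulr_ge0// exprn_ge0.
elim: n => [|n IHn]; first by rewrite big_nil expr0 add0r mulr1.
apply: le_trans IHn; rewrite big_nat_recr//= -addrA lerD2l.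
have -> : 2 * x ^+ n = x ^+ n + x ^+ n by rewrite mulr_natl mulr2n.
rewrite lerD2l exprS mulrA -[leRHS]mul1r ler_wpM2r ?exprn_ge0//.
by rewrite mulrC -ler_pdivlMr.
Qed.

(** If [a m] is the first non-zero coefficient of a power series, the later terms
are dominated by a geometric series of ratio [`|w| / r], so that for small [w]
they sum to at most half of the leading term.  The bound is uniform in [n], hence
survives in the limit. *)
Lemma series_norm_ge (K : numFieldType) (a : nat -> K) (r M w : K) m n :
  0 < r -> (forall k, `|a k| * r ^+ k <= M) ->
  (forall k, (k < m)%N -> a k = 0) ->
  `|w| * 2 <= r -> `|w| * (4 * M) <= r * (`|a m| * r ^+ m) -> (m < n)%N ->
  `|a m * w ^+ m| / 2 <= `|series (fun k => a k * w ^+ k) n|.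
Proof.
move=> r0 aM a0 wr wM mn; have rn0 : r != 0 by rewrite gt_eqF.
set x := `|w| / r.
have x0 : 0 <= x by rewrite divr_ge0// ltW.
have x12 : x <= 1 / 2 by rewrite ler_pdivrMr// mul1r mulrC ler_pdivlMr.
have wE k : `|a k * w ^+ k| = `|a k| * r ^+ k * x ^+ k.
  by rewrite normrM normrX -mulrA -exprMn mulrC /x mulrCA divff// mulr1 mulrC.
have M0 : 0 <= M by apply: le_trans (aM 0%N); rewrite mulr_ge0// exprn_ge0// ltW.
have -> : series (fun k => a k * w ^+ k) n =
    a m * w ^+ m + \sum_(m.+1 <= k < n) a k * w ^+ k.
  rewrite /series/= (big_cat_nat _ (n := m.+1))//= big_nat_recr//=.
  congr (_ + _); rewrite big_nat big1 ?add0r// => k /andP[_ km].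
  by rewrite a0// mul0r.
apply: le_trans (lerB_normD _ _); rewrite lerBrDr -lerBrDl.
have -> : `|a m * w ^+ m| - `|a m * w ^+ m| / 2 = `|a m * w ^+ m| / 2.
  by rewrite {1}(splitr `|a m * w ^+ m|) addrK.
apply: (@le_trans _ _ (M * x ^+ m.+1 * 2)).
  apply: le_trans (ler_norm_sum _ _ _) _.
  apply: (@le_trans _ _ (\sum_(m.+1 <= k < n) M * x ^+ k)).
    by apply: ler_sum => k _; rewrite wE ler_wpM2r// exprn_ge0.
  rewrite -{1}[m.+1]add0n big_addn -mulr_sumr -mulrA ler_wpM2l//.
  under eq_bigr do rewrite addnC exprD.
  by rewrite -mulr_sumr ler_wpM2l ?exprn_ge0// sum_expr_le2.
rewrite ler_pdivlMr// wE.
have -> : M * x ^+ m.+1 * 2 * 2 = x * (4 * M) * x ^+ m by rewrite exprS; ring.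
rewrite ler_wpM2r ?exprn_ge0//.
by rewrite /x mulrAC ler_pdivrMr// [leRHS]mulrC.
Qed.

Section identity_theorem.
Variable R : realType.
Implicit Types (f : R[i] -> R[i]) (z : R[i]) (D : set R[i]).

(** The first case occurs when all coefficients are zero; otherwise the first
non-zero one governs the behaviour near [z0]. *)
Lemma analytic_at_isolated_zero f z0 : analytic_at f z0 ->
  (\forall z \near z0, f z = 0) \/ (\forall z \near z0^', f z != 0).
Proof.
move=> [a fa].
have [a0|/existsNP[k0 ak0]] := pselect (forall k, a k = 0).
  left; apply: filterS fa => z.
  have -> : [series a k * (z - z0) ^+ k]_k = cst 0.
    by apply/funext => n; rewrite /series/= big1// => k _; rewrite a0 mul0r.
  by move=> /cvg_lim <- //; exact: lim_cst.
right.
have ex_a : exists k, a k != 0 by exists k0; exact/eqP.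
have [m am min_m] := ex_minnP ex_a.
have a_lt_m k : (k < m)%N -> a k = 0.
  by move=> km; apply: contraTeq km => /min_m; rewrite -leqNgt.
(* Boundedness of the terms at the single point [z0 + r] yields the geometric
   domination needed by [series_norm_ge]. *)
have [M /nbhs_ballP[e /= e0 aM]] := analytic_at_bound fa.
pose r := e / 2.
have r0 : 0 < r by rewrite divr_gt0.
have {}aM k : `|a k| * r ^+ k <= M / 8 ^+ k.
  have zr : ball z0 e (z0 + r).
    rewrite -ball_normE/= opprD addNKr normrN gtr0_norm// ltr_pdivrMr//.
    by rewrite mulr_natr mulr2n ltrDl.
  have := aM _ zr k; rewrite (addrC z0) addrK normrM normrX.
  by rewrite (gtr0_norm r0).
have M0 : 0 <= M.
  by have := aM 0%N; rewrite !expr0 mulr1 divr1; exact: le_trans.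
have {}aM k : `|a k| * r ^+ k <= M.
  apply: le_trans (aM k) _; rewrite ler_pdivrMr ?exprn_gt0// ler_peMr//.
  by rewrite exprn_ege1// ler1n.
have arm : 0 < `|a m| * r ^+ m by rewrite mulr_gt0 ?normr_gt0// exprn_gt0.
have {}M0 : 0 < M by exact: lt_le_trans (aM m).
have near_lt d : 0 < d -> \forall z \near z0, `|z - z0| < d.
  by move=> d0; apply/nbhs_ballP; exists d => //= z; rewrite -ball_normE/= distrC.
have z1 := near_lt (r / 2) (divr_gt0 r0 (ltr0Sn _ _)).
have z2 := near_lt (r * (`|a m| * r ^+ m) / (4 * M))
  (divr_gt0 (mulr_gt0 r0 arm) (mulr_gt0 (ltr0Sn _ _) M0)).
rewrite near_withinE.
apply: filterS3 fa z1 z2 => z Sz /ltW z1 /ltW z2 zz0.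
(* A limit [0] would bring the partial sums below half of the leading term. *)
apply/eqP => fz0; move: Sz; rewrite fz0 => /cvgrPdist_lt.
set c := `|a m * (z - z0) ^+ m| / 2.
have c0 : 0 < c.
  by rewrite divr_gt0// normr_gt0 mulf_neq0// expf_neq0// subr_eq0.
move=> /(_ c c0) Sc.
have [n [/= mn]] := filter_ex (filterI (nbhs_infty_gt m) Sc).
rewrite sub0r normrN; apply/negP; rewrite -real_leNgt ?normr_real ?gtr0_real//.
apply: (series_norm_ge r0 aM) => //.
  by rewrite -ler_pdivlMr.
by rewrite -ler_pdivlMr// mulr_gt0.
Qed.

(** The points near which [f] vanishes form an open set.  It is relatively closed
in [D]: every neighbourhood of a limit point [w] contains zeros of [f], which
leaves only the first case of [analytic_at_isolated_zero] at [w]. *)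
Lemma identity_theorem D f : connected D ->
  (forall z, D z -> analytic_at f z) ->
  (exists2 z, D z & \forall w \near z, f w = 0) ->
  forall z, D z -> f z = 0.
Proof.
move=> cD fa [z0 Dz0 fz0] z Dz.
pose Z := [set w | f w = 0]°.
suff DZ : D `&` Z = D.
  by move: Dz; rewrite -DZ => [] [_ /interior_subset].
apply: cD; first by exists z0.
  by exists Z => //; exact: open_interior.
exists (closure Z); first exact: closed_closure.
apply/seteqP; split=> [w [Dw Zw]|w [Dw Zw]].
  by split; [exact: Dw|exact: subset_closure].
split; first exact: Dw.
have [//|fN0] := analytic_at_isolated_zero (fa _ Dw).
move: fN0; rewrite near_withinE => fN0.
have [v [Zv fv]] := Zw _ fN0.
have [vw|vw] := eqVneq v w; first by rewrite -vw.
have fv0 : f v = 0 by exact: (interior_subset Zv).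
case: (elimN eqP (fv vw) fv0).
Qed.

Lemma continuous_scale_real z : continuous (fun t : R => t%:C * z).
Proof.
move=> t; apply/cvgrPdist_lt => e e0.
have z1 : 0 < `|z| + 1 by rewrite ltr_wpDl.
have ez0 : 0 < e / (`|z| + 1) by rewrite divr_gt0.
have ezE : (complex.Re (e / (`|z| + 1)))%:C = e / (`|z| + 1).
  exact/RRe_real/gtr0_real.
have : 0 < complex.Re (e / (`|z| + 1)) by rewrite -ltcR ezE.
move=> d0; apply/nbhs_ballP; exists (complex.Re (e / (`|z| + 1))) => // s.
move=> st; have {}st : `|(t : R) - s| < complex.Re (e / (`|z| + 1)) := st.
rewrite -ltcR ezE in st; rewrite -mulrBl -rmorphB normrM normc_def/=.
rewrite expr0n/= addr0 sqrtr_sqr.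
apply: (@le_lt_trans _ _ (`|t - s|%:C * (`|z| + 1))).
  by rewrite ler_wpM2l ?lecR// lerDl.
by rewrite -ltr_pdivlMr.
Qed.

(** The disk is the union of its radii, segments that share the point [0]. *)
Lemma connected_unit_disk : connected (unit_disk R).
Proof.
have -> : unit_disk R =
    \bigcup_(z in unit_disk R) [set t%:C * z | t in `[0, 1]%classic].
  apply/seteqP; split=> [z Dz|_ [z Dz [t + <-]]].
    exists z => //; exists 1; last by rewrite mul1r.
    by rewrite /= in_itv/= ler01 lexx.
  rewrite /= in_itv/= => /andP[t0 t1]; rewrite /unit_disk/= normrM normc_def/=.
  rewrite expr0n/= addr0 sqrtr_sqr; apply: le_lt_trans Dz.
  by rewrite ler_piMl// -[1]/(1%:C) lecR ger0_norm.
apply: bigcup_connected => [|z _].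
  exists 0 => z _; exists 0; last by rewrite mul0r.
  by rewrite /= in_itv/= ler01 lexx.
apply: connected_continuous_connected; first exact: segment_connected.
exact/continuous_subspaceT/continuous_scale_real.
Qed.

End identity_theorem.

Lemma valL_val R (f : closed_unit_disk R -> R[i]) x : 'valL_ 0 f (\val x) = f x.
Proof. by rewrite -[RHS](congr1 (@^~ x) (valLK 0 f)). Qed.

(** Density of the open disk in its closure: a non-zero value at a boundary point
would persist at points of the open disk. *)
Lemma eq0_on_unit_disk R (f : closed_unit_disk R -> R[i]) : continuous f ->
  (forall x, unit_disk R (\val x) -> f x = 0) -> f = 0.
Proof.
move=> cf f0; apply/funext => x; apply/eqP; apply: contrapT => /negP fx.
have : nbhs (f x) [set w | w != 0].
  apply/nbhs_ballP; exists `|f x| => [|w]; first by rewrite /= normr_gt0.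
  by rewrite -ball_normE/=; apply: contraTneq => ->; rewrite subr0 ltxx.
(* A neighbourhood of [x] in the closed disk is the trace of an open set [W] of
   the plane, and [W] meets the open disk. *)
move=> /cf [_ /= [[W oW <-] /= Wx WN0]].
have : closure (unit_disk R) (\val x) by exact/set_mem/(valP x).
move=> /(_ W (open_nbhs_nbhs (conj oW Wx)))[w [Dw Ww]].
have cw : w \in closed_unit_disk R by exact/mem_set/subset_closure.
have := WN0 (exist _ w cw) Ww.
by rewrite /= f0 ?eqxx.
Qed.

Lemma disk_algebra_eq0 R (f : disk_algebra R) :
  (\forall z \near (0 : R[i]), 'valL_ 0 f z = 0) -> f = 0.
Proof.
move=> f0; have [fc fa] := set_mem (disk_valP f).
apply: val_inj; apply: eq0_on_unit_disk fc _ => x Dx.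
rewrite -valL_val; apply: (identity_theorem (@connected_unit_disk R) fa) => //.
by exists 0 => //; rewrite /unit_disk/= normr0.
Qed.

(** A point of the disk near [0], other than [0], witnesses that [f * g] is not
zero when neither factor vanishes near [0]. *)
Lemma disk_algebra_mul_eq0 R (f g : disk_algebra R) :
  f * g = 0 -> f = 0 \/ g = 0.
Proof.
move=> fg0.
have D0 : unit_disk R 0 by rewrite /unit_disk/= normr0.
have [_ fa] := set_mem (disk_valP f); have [_ ga] := set_mem (disk_valP g).
have [f0|fN0] := analytic_at_isolated_zero (fa _ D0).
  by left; exact: disk_algebra_eq0.
have [g0|gN0] := analytic_at_isolated_zero (ga _ D0).
  by right; exact: disk_algebra_eq0.
have nD : nbhs (0 : R[i]) (unit_disk R).
  exact/open_nbhs_nbhs/(conj (@open_unit_disk R)).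
have [w [[fw gw] Dw]] := filter_ex (filterI (filterI fN0 gN0) (nbhs_dnbhs nD)).
have cw : w \in closed_unit_disk R by exact/mem_set/subset_closure.
have := congr1 (fun h : disk_algebra R => h (exist _ w cw)) fg0.
move/eqP; rewrite [X in X == _](_ : _ = f (exist _ w cw) * g (exist _ w cw))//.
rewrite mulf_eq0 => /orP[] /eqP; rewrite -valL_val => h.
  case: (elimN eqP fw h).
case: (elimN eqP gw h).
Qed.

Theorem proposition1 (R : realType) (f : disk_algebra R) :
  zero_divisor f <-> f = 0.
Proof.
split=> [[[g gN0 /disk_algebra_mul_eq0]|[g gN0 /disk_algebra_mul_eq0]]|->].
- by move=> [//|g0]; rewrite g0 eqxx in gN0.
- by move=> [g0|//]; rewrite g0 eqxx in gN0.
left; exists 1; last exact: mul0r.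
have c0 : (0 : R[i]) \in closed_unit_disk R.
  by apply/mem_set/subset_closure; rewrite /unit_disk/= normr0.
apply/eqP => /(congr1 (fun h : disk_algebra R => h (exist _ 0 c0))).
by move/eqP; rewrite oner_eq0.
Qed.
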